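(* Let $a,b$ be positive integers and let $\{F_n(q)\}_{n\geq 0}$ be the $q$-biperiodic Fibonacci sequence. For every integer $n\geq 0$, $$a\sum_{k=0}^{n}F_{2k+1}(q)\,q^{n^2+n-(k^2+k)}=F_{2n+2}(q).$$
   Context: Fix positive integers $a,b$; $q$ is an indeterminate. The $q$-biperiodic Fibonacci sequence is defined by $F_0(q)=0$, $F_1(q)=1$ and, for $n\geq 2$, $F_n(q)=aF_{n-1}(q)+q^{n-2}F_{n-2}(q)$ if $n$ is even, $F_n(q)=bF_{n-1}(q)+q^{n-2}F_{n-2}(q)$ if $n$ is odd. *)

(* Defs.v *)
From mathcomp Require Import all_boot all_order all_algebra.
Set Implicit Arguments.
Unset Strict Implicit.
Unset Printing Implicit Defensive.
Import GRing.Theory.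
Local Open Scope ring_scope.

(* The indeterminate q is 'X.  In the recursive case n = m.+2, so 'X^m is
   q^(n-2). *)
Fixpoint qbifib (a b n : nat) : {poly int} :=
  match n with
  | 0 => 0
  | m'.+1 =>
    match m' with
    | 0 => 1
    | m.+1 => (if odd n then b else a)%:R * qbifib a b m' + 'X^m * qbifib a b m
    end
  end.

(* Main.v *)
Require Import Defs.
From mathcomp Require Import all_boot all_order all_algebra.
From mathcomp Require Import zify.
Import GRing.Theory.
Local Open Scope ring_scope.

(** Induction on [n]: passing from [n] to [n.+1] multiplies every old summand by ['X^(2 * n + 2)]
    and adds one new term, so the claim becomes the recurrence for the even index [2 * n + 4]. *)

Lemma qbifibSS (a b n : nat) :
  qbifib a b n.+2 =
    (if odd n then b else a)%:R * qbifib a b n.+1 + 'X^n * qbifib a b n.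
Proof. by rewrite [LHS]/= negbK. Qed.

Theorem theorem14 (a b : nat) (ha : (0 < a)%N) (hb : (0 < b)%N) (n : nat) :
  a%:R * (\sum_(0 <= k < n.+1)
            qbifib a b (2 * k + 1) * 'X^(n ^ 2 + n - (k ^ 2 + k)))
  = qbifib a b (2 * n + 2).
Proof.
elim: n => [|n IHn].
  by rewrite big_nat1 /= expr0 !mulr1 mulr0 addr0.
rewrite big_nat_recr // subnn expr0 mulr1 mulrDr.
(* The factor is the increment of [n ^ 2 + n], namely [2 * n + 2]; the bound [k <= n] keeps the
   truncated subtractions exact. *)
have shift k : (0 <= k < n.+1)%N ->
    qbifib a b (2 * k + 1) * 'X^(n.+1 ^ 2 + n.+1 - (k ^ 2 + k)) =
    'X^(2 * n + 2) *
      (qbifib a b (2 * k + 1) * 'X^(n ^ 2 + n - (k ^ 2 + k))).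
  move=> /andP[_ lt_kn]; rewrite mulrCA -exprD; congr (_ * 'X^_).
  by nia.
rewrite (eq_big_nat _ _ shift) -mulr_sumr mulrCA IHn.
have -> : (2 * n.+1 + 2 = (2 * n + 2).+2)%N by lia.
have -> : (2 * n.+1 + 1 = (2 * n + 2).+1)%N by lia.
(* As [2 * n + 2] is even, the recurrence has coefficient [a], matching the new term. *)
by rewrite qbifibSS oddD oddM /= addrC.
Qed.
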